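(* Consider the double random process, in which the integers $d_n$ ($n=0,1,2,\ldots$) are independent random variables with $d_n\in\{0,1,\ldots,n\}$. If there exist $\epsilon>0$, $p_0>0$ and an integer $M$ such that for all $n>M$, $\Pr[\epsilon n\le d_n\le(1-\epsilon)n]\ge p_0$, then the double random process almost surely generates the Rado graph.
   Context: Double random process: first a random sequence $\{d_n\}_{n=0}^\infty$ is chosen, where $d_n$ has some given distribution on $\{0,1,\ldots,n\}$ and the $d_n$ are independent. Then, given the sequence, a random graph on the vertex set $\{v_0,v_1,v_2,\ldots\}$ is generated as follows. In round $i=0,1,2,\ldots$, independently of the other rounds, a subset $A\subseteq\{v_0,\ldots,v_{i-1}\}$ of cardinality $d_i$ is chosen uniformly at random among all subsets of that cardinality, and $v_i$ is joined by an edge to every vertex of $A$. The Rado graph is the (unique up to isomorphism) countably infinite graph such that for all disjoint finite sets $A,B$ of vertices there are infinitely many vertices adjacent to every element of $A$ and to no element of $B$. ''Generates the Rado graph'' means that the generated graph is isomorphic to it. *)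

(* Defs.v *)
From HB Require Import structures.
From mathcomp Require Import all_boot all_order all_algebra finmap.
From mathcomp Require Import all_classical all_reals all_analysis.

Set Implicit Arguments.
Unset Strict Implicit.
Unset Printing Implicit Defensive.

Import Order.TTheory GRing.Theory Num.Theory.

Local Open Scope classical_set_scope.
Local Open Scope ring_scope.

Record simple_graph (V : Type) := SimpleGraph {
  adj :> rel V;
  adj_sym : symmetric adj;
  adj_irr : irreflexive adj }.

Definition graph_isomorphic (V W : Type)
    (G : simple_graph V) (H : simple_graph W) : Prop :=
  exists2 f : V -> W, bijective f & forall x y, H (f x) (f y) = G x y.

Definition is_rado_graph (V : Type) (G : simple_graph V) : Prop :=
  ([set: V] #= [set: nat])%card /\
  forall A B : set V, finite_set A -> finite_set B -> A `&` B = set0 ->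
    infinite_set [set v | (forall a, A a -> G v a) /\
                          (forall b, B b -> ~~ G v b)].

(* A witness: n codes a finite sequence of naturals, and i < j are adjacent
   iff i occurs in the sequence coded by j. *)
Section rado_exists.
Local Open Scope nat_scope.

Let code_adj : rel nat := fun i j =>
  (i < j) && (i \in odflt [::] (@choice.unpickle (seq nat) j)).

Let code_rel : rel nat := fun i j => code_adj i j || code_adj j i.

Let code_sym : symmetric code_rel.
Proof. by move=> i j; rewrite /code_rel orbC. Qed.

Let code_irr : irreflexive code_rel.
Proof. by move=> i; rewrite /code_rel /code_adj ltnn. Qed.

Lemma rado_graph_exists : exists G : simple_graph nat, is_rado_graph G.
Proof.
exists (SimpleGraph code_sym code_irr); split; first exact: card_eqxx.
move=> A B finA finB AB0.
have [s sA] : exists s : seq nat, A = [set` s] by apply/finite_seqP.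
have bnd C : finite_set C -> exists N, forall c : nat, C c -> c <= N.
  move=> /finite_seqP[t ->]; exists (\max_(i <- t) i) => c /= ct.
  exact: (@leq_bigmax_seq _ t xpredT id).
have [N AN] := bnd _ finA; have [M BM] := bnd _ finB.
pose f k : nat := choice.pickle (k :: s).
have finj : injective f by move=> k l /(pcan_inj choice.pickleK)[].
set X := (X in infinite_set X).
have fX k : M < k -> N < f k -> M < f k -> X (f k).
  move=> Mk Nf Mf; split => [a Aa|b Bb] /=; rewrite /code_rel /code_adj.
    apply/orP; right; rewrite (leq_ltn_trans (AN _ Aa) Nf) /f choice.pickleK /=.
    by move: Aa; rewrite sA /= inE orbC => ->.
  rewrite negb_or; apply/andP; split.
    by rewrite ltnNge (leq_trans (BM _ Bb) (ltnW Mf)).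
  rewrite negb_and; apply/orP; right; rewrite /f choice.pickleK /= inE negb_or.
  rewrite neq_ltn (leq_ltn_trans (BM _ Bb) Mk) /=.
  apply/negP => bs; have : (A `&` B) b by split=> //; rewrite sA.
  by rewrite AB0.
apply: (@sub_infinite_set _ (range f `\` (f @` `I_M.+1 `|` `I_(maxn N M).+1))).
  move=> _ [[k _ <-]] /not_orP[nk nf]; apply: fX.
  - by rewrite ltnNge; apply/negP => kM; apply: nk; exists k.
  - by rewrite ltnNge; apply/negP => h; apply: nf => /=; rewrite ltnS leq_max h.
  - by rewrite ltnNge; apply/negP => h; apply: nf => /=; rewrite ltnS leq_max h orbT.
apply: infinite_setD.
  move=> /(finite_preimage (fun x y _ _ => @finj x y)); rewrite preimage_range.
  exact: infinite_nat.
rewrite finite_setU; split; last exact: finite_II.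
by apply: finite_image; exact: finite_II.
Qed.

End rado_exists.

(* Known only through its defining property, which determines it up to
   isomorphism. *)
Definition rado_graph : simple_graph nat := projT1 (cid rado_graph_exists).

Lemma rado_graphP : is_rado_graph rado_graph.
Proof. exact: projT2 (cid rado_graph_exists). Qed.

Section generated_graph.
Variable A : forall n, {set 'I_n}.

Definition joined_to : rel nat := fun j i => [exists k in A j, val k == i].

Definition generated_adj : rel nat := fun i j => joined_to i j || joined_to j i.

Lemma generated_adj_sym : symmetric generated_adj.
Proof. by move=> i j; rewrite /generated_adj orbC. Qed.

Lemma generated_adj_irr : irreflexive generated_adj.
Proof.
move=> i; rewrite /generated_adj orbb; apply/negbTE/negP.
by move=> /existsP[k /andP[_ /eqP ki]]; have := ltn_ord k; rewrite [X in (X < _)%N]ki ltnn.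
Qed.

Definition generated_graph : simple_graph nat :=
  SimpleGraph generated_adj_sym generated_adj_irr.

End generated_graph.

Definition mutually_independent d (T : measurableType d) (R : realType)
    (P : probability T R) d' (S : measurableType d')
    (X : nat -> {RV P >-> S}) : Prop :=
  forall (J : {fset nat}) (B : nat -> set S),
    (forall n, measurable (B n)) ->
    P (\bigcap_(n in [set` J]) (X n @^-1` B n)) =
    (\prod_(n <- J) P (X n @^-1` B n))%E.

Definition sigma_generated d (T : measurableType d) (R : realType)
    (P : probability T R) d' (S : measurableType d')
    (X : nat -> {RV P >-> S}) : set (set T) :=
  <<s [set E | exists n (B : set S), measurable B /\ E = X n @^-1` B] >>.

Definition uniform_subset_pmf (R : realType) (n k : nat) (a : {set 'I_n}) : R :=
  if #|a| == k then ('C(n, k)%:R)^-1 else 0.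

(* [nbrs n w] is the set of indices of the earlier vertices to which v_n is
   joined. The last field says that the conditional law of [nbrs] given the
   whole sequence [degree] is the product over the rounds n of the uniform laws
   on the subsets of size [degree n]: for every finite set J of rounds,
   P (nbrs n = a n for all n in J | degree) = \prod_(n in J) pmf_n (a n)
   almost surely, stated by integration over the events E determined by the
   sequence [degree]. *)
Record double_random_process d (T : measurableType d) (R : realType)
    (P : probability T R) := DoubleRandomProcess {
  degree : nat -> {RV P >-> nat};
  degree_le : forall n w, (degree n w <= n)%N;
  degree_indep : mutually_independent degree;
  nbrs : forall n, T -> {set 'I_n};
  nbrs_measurable : forall n (a : {set 'I_n}), measurable (nbrs n @^-1` [set a]);
  nbrs_cond_law : forall (J : {fset nat}) (a : forall n, {set 'I_n}) (E : set T),
    sigma_generated degree E ->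
    P (E `&` \bigcap_(n in [set` J]) (nbrs n @^-1` [set a n])) =
    (\int[P]_(w in E)
       (\prod_(n <- J) uniform_subset_pmf R (degree n w) (a n))%:E)%E }.

Definition process_graph d (T : measurableType d) (R : realType)
    (P : probability T R) (D : double_random_process P) (w : T) :
    simple_graph nat :=
  generated_graph (fun n => nbrs D n w).

(* Main.v *)
Require Import Defs.
From HB Require Import structures.
From mathcomp Require Import all_boot all_order all_algebra finmap.
From mathcomp Require Import all_classical all_reals all_analysis.
From mathcomp Require Import lra zify.

(** A countable graph is isomorphic to the Rado graph as soon as every pair of
disjoint finite vertex sets A and B is realized by a vertex outside B that is
adjacent to all of A and to none of B: any two countable graphs with this
extension property are isomorphic by the back-and-forth construction
([extension_property_isomorphic]).  So it is enough to realize almost surely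
each of the countably many pairs (A, B), and, by countable additivity, to treat
one pair at a time.

Fix A and B.  Let n be large and suppose that the degree k of v_n lies between
eps n and (1 - eps) n.  A uniform k-subset of the n earlier vertices contains A
and avoids B with probability C(n - a - b, k - a) / C(n, k), where a and b are
the sizes of A and B.  This ratio is a product of a + b fractions, each of them
at least eps / 2 for n large ([bin_ge_expr]).  Hence v_n realizes the pair with
probability at least c = (eps / 2) ^ (a + b) * p0, a bound that does not depend
on n ([nbrs_between_ge]).

The rounds are independent: the pairs (degree, neighbourhood) have a product law
on finite sets of rounds, because given the degrees the neighbourhoods are
independent with laws depending on their own degree only, and the degrees are
themselves independent ([rounds_law]).  The probability that m given late rounds
all miss the pair is therefore at most (1 - c) ^ m, which tends to 0
([independent_negligible], one half of the second Borel-Cantelli lemma). *)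

Set Implicit Arguments.
Unset Strict Implicit.
Unset Printing Implicit Defensive.

Import Order.TTheory GRing.Theory Num.Theory.
Import numFieldNormedType.Exports.

Local Open Scope classical_set_scope.
Local Open Scope ring_scope.

(** * Uniqueness of countable graphs with the extension property *)

Definition extension_property (V : eqType) (G : simple_graph V) : Prop :=
  forall A B : seq V, {in A, forall a, a \notin B} ->
    exists v, [/\ v \notin A ++ B, {in A, forall a, G v a} &
                  {in B, forall b, ~~ G v b}].

(** Infinitely many witnesses cannot all lie in the finite set A ++ B. *)
Lemma rado_extension_property (V : choiceType) (G : simple_graph V) :
  is_rado_graph G -> extension_property G.
Proof.
move=> [_ radoG] A B AB.
have AB0 : [set` A] `&` [set` B] = set0.
  by rewrite -subset0 => x [/= /AB /negP].
have := infinite_setD (radoG _ _ (finite_seq A) (finite_seq B) AB0)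
  (finite_seq (A ++ B)).
by move=> /infinite_setN0[v [[vA vB] /negP vAB]]; exists v.
Qed.

(** The finite partial map is kept as its list of pairs, so that the roles of the
two graphs are exchanged by [converse]; the condition on equalities says that
the list is the graph of an injective function. *)
Definition partial_isomorphism (V W : eqType) (G : simple_graph V)
    (H : simple_graph W) (s : seq (V * W)) : Prop :=
  {in s &, forall p q,
    (p.1 == q.1) = (p.2 == q.2) /\ G p.1 q.1 = H p.2 q.2}.

Definition converse (V W : Type) (s : seq (V * W)) : seq (W * V) :=
  [seq (p.2, p.1) | p <- s].

Lemma converseK (V W : Type) : cancel (@converse V W) (@converse W V).
Proof. by elim=> [//|[x y] s /= ->]. Qed.

Lemma partial_isomorphism_converse (V W : eqType) (G : simple_graph V)
    (H : simple_graph W) (s : seq (V * W)) :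
  partial_isomorphism G H s -> partial_isomorphism H G (converse s).
Proof.
by move=> iso _ _ /mapP[p ps ->] /mapP[q qs ->] /=; have [-> ->] := iso _ _ ps qs.
Qed.

(** The image of a new vertex x is a vertex of H realizing, over the range of the
partial map, the same adjacencies as x has over its domain. *)
Lemma partial_isomorphism_forth (V W : eqType) (G : simple_graph V)
    (H : simple_graph W) (s : seq (V * W)) (x : V) :
  extension_property H -> partial_isomorphism G H s ->
  exists y, partial_isomorphism G H ((x, y) :: s).
Proof.
move=> extH iso; have [/mapP[[x' y] xys /= xx']|xs] := boolP (x \in unzip1 s).
  rewrite -{x'}xx' in xys.
  by exists y => p q; rewrite !inE => /predU1P[->|ps] /predU1P[->|qs]; apply: iso.
pose A := [seq p.2 | p <- s & G x p.1].
pose B := [seq p.2 | p <- s & ~~ G x p.1].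
have [|y [yAB yA yB]] := extH A B.
  move=> _ /mapP[p pA ->]; move: pA; rewrite mem_filter => /andP[xp ps].
  apply/negP => /mapP[q]; rewrite mem_filter => /andP[xq qs] /eqP pq.
  by have [] := iso _ _ ps qs; rewrite pq => /eqP pq1; rewrite -pq1 xp in xq.
have ext p : p \in s -> (x == p.1) = (y == p.2) /\ G x p.1 = H y p.2.
  move=> ps; have pAB : p.2 \in A ++ B.
    rewrite mem_cat; have [xp|xp] := boolP (G x p.1).
      by rewrite map_f// mem_filter xp.
    by apply/orP; right; rewrite map_f// mem_filter xp.
  split.
    apply/eqP/eqP => [xp|yp]; first by rewrite xp map_f in xs.
    by rewrite yp pAB in yAB.
  have [xp|xp] := boolP (G x p.1).
    by rewrite yA// map_f// mem_filter xp.
  by apply/esym/negbTE/yB; rewrite map_f// mem_filter xp.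
exists y => p q; rewrite !inE => /predU1P[->|ps] /predU1P[->|qs] /=.
- by rewrite !eqxx !adj_irr.
- exact: ext.
- by have [e1 e2] := ext _ ps; rewrite eq_sym e1 eq_sym adj_sym e2 adj_sym.
- exact: iso.
Qed.

(** One round of back-and-forth takes care of the n-th vertex of both graphs.
A code n that denotes no vertex requires nothing. *)
Lemma partial_isomorphism_step (V W : countType) (G : simple_graph V)
    (H : simple_graph W) (s : seq (V * W)) (n : nat) :
  extension_property G -> extension_property H -> partial_isomorphism G H s ->
  exists t, [/\ partial_isomorphism G H t, {subset s <= t},
    forall x : V, choice.pickle x = n -> x \in unzip1 t &
    forall y : W, choice.pickle y = n -> y \in unzip2 t].
Proof.
move=> extG extH iso.
have [t [isot st tx]] : exists t, [/\ partial_isomorphism G H t, {subset s <= t} &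
    forall x : V, choice.pickle x = n -> x \in unzip1 t].
  case E : (@choice.unpickle V n) => [x|].
    have [y iso'] := partial_isomorphism_forth x extH iso.
    exists ((x, y) :: s); split=> // [p ps|z zn]; first by rewrite inE ps orbT.
    by move: E; rewrite -zn choice.pickleK => -[->]; rewrite inE eqxx.
  by exists s; split=> // z zn; move: E; rewrite -zn choice.pickleK.
(* The back half is the forth half for the converse map. *)
case E : (@choice.unpickle W n) => [y|].
  have [x] := partial_isomorphism_forth y extG (partial_isomorphism_converse isot).
  move=> /partial_isomorphism_converse; rewrite /= converseK => iso'.
  exists ((x, y) :: t); split=> // [p /st ps|z zn|z zn].
  - by rewrite inE ps orbT.
  - by rewrite inE tx ?orbT.
  - by move: E; rewrite -zn choice.pickleK => -[->]; rewrite inE eqxx.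
by exists t; split=> // z zn; move: E; rewrite -zn choice.pickleK.
Qed.

(** The union of the increasing chain of partial isomorphisms built by the
back-and-forth steps is total and surjective, hence an isomorphism. *)
Lemma extension_property_isomorphic (V W : countType) (G : simple_graph V)
    (H : simple_graph W) :
  extension_property G -> extension_property H -> graph_isomorphic G H.
Proof.
move=> extG extH.
pose iso_type := {s : seq (V * W) | partial_isomorphism G H s}.
have /choice[next nextP] : forall ns : nat * iso_type, exists t : iso_type,
    [/\ {subset sval ns.2 <= sval t},
    forall x : V, choice.pickle x = ns.1 -> x \in unzip1 (sval t) &
    forall y : W, choice.pickle y = ns.1 -> y \in unzip2 (sval t)].
  move=> [n [s iso]]; have [t [isot *]] := partial_isomorphism_step n extG extH iso.
  by exists (exist _ t isot).
have iso0 : partial_isomorphism G H [::] by [].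
pose chain := fix chain n : iso_type :=
  if n is m.+1 then next (m, chain m) else exist _ [::] iso0.
have chain_sub m n : (m <= n)%N -> {subset sval (chain m) <= sval (chain n)}.
  elim: n => [|n IH]; first by rewrite leqn0 => /eqP ->.
  rewrite leq_eqVlt ltnS => /predU1P[->//|/IH mn] p /mn.
  by have [+ _ _] := nextP (n, chain n); apply.
pose matched x y := exists n, (x, y) \in sval (chain n).
have /choice[f fP] : forall x, exists y, matched x y.
  move=> x; have [_ + _] := nextP (choice.pickle x, chain (choice.pickle x)).
  move=> /(_ x erefl)/mapP[[x' y] xy /= ->].
  by exists y, (choice.pickle x).+1.
have /choice[g gP] : forall y, exists x, matched x y.
  move=> y; have [_ _] := nextP (choice.pickle y, chain (choice.pickle y)).
  move=> /(_ y erefl)/mapP[[x y'] xy /= ->].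
  by exists x, (choice.pickle y).+1.
have matched_iso x y x' y' : matched x y -> matched x' y' ->
    (x == x') = (y == y') /\ G x x' = H y y'.
  move=> [m xy] [n xy']; have iso := svalP (chain (maxn m n)).
  by have := iso _ _ (chain_sub _ _ (leq_maxl m n) _ xy)
                     (chain_sub _ _ (leq_maxr m n) _ xy').
exists f => [|x y]; last by have [_ ->] := matched_iso _ _ _ _ (fP x) (fP y).
exists g => [x|y].
  by apply/eqP; have [-> _] := matched_iso _ _ _ _ (gP (f x)) (fP x).
by apply/eqP; have [<- _] := matched_iso _ _ _ _ (fP (g y)) (gP y).
Qed.

(** * Counting subsets that contain A and avoid B *)

(** C(N - 1, K - 1) is K / N times C(N, K), and C(N - 1, K) is (N - K) / N times
C(N, K).  Going down from C(a + b + (i + j), a + i) to C(i + j, i) takes a steps of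
the first kind and b of the second; throughout, K >= i, N - K >= j and N is at most
a + b + (i + j), so that each factor is at least delta. *)
Lemma bin_ge_expr (R : realFieldType) (delta : R) (a b i j : nat) :
  0 <= delta -> delta * (a + b + (i + j))%:R <= i%:R ->
  delta * (a + b + (i + j))%:R <= j%:R ->
  delta ^+ (a + b) * 'C(a + b + (i + j), a + i)%:R <= 'C(i + j, i)%:R.
Proof.
move=> d0; elim: a => [|a IH].
  rewrite !add0n; elim: b => [|b IH]; first by rewrite !add0n expr0 mul1r.
  have le_n : delta * (b + (i + j))%:R <= delta * (b.+1 + (i + j))%:R.
    by rewrite ler_wpM2l// ler_nat leq_add2r.
  move=> hi hj; have {IH} := IH (le_trans le_n hi) (le_trans le_n hj).
  apply: le_trans; rewrite exprSr -mulrA ler_wpM2l ?exprn_ge0//.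
  rewrite -(@ler_pM2l _ (b.+1 + (i + j))%:R) ?ltr0n// mulrCA mulrA -natrM.
  rewrite [X in _ <= X%:R]mul_bin_down natrM ler_wpM2r//.
  by rewrite (le_trans hj)// ler_nat; lia.
have le_n : delta * (a + b + (i + j))%:R <= delta * (a.+1 + b + (i + j))%:R.
  by rewrite ler_wpM2l// ler_nat leq_add2r leq_add2r.
move=> hi hj; have {IH} := IH (le_trans le_n hi) (le_trans le_n hj).
apply: le_trans; rewrite !addSn exprSr -mulrA ler_wpM2l ?exprn_ge0//.
rewrite -(@ler_pM2l _ (a + b + (i + j)).+1%:R) ?ltr0n// mulrCA mulrA -natrM.
rewrite [X in _ <= X%:R](mul_bin_diag (a + b + (i + j)).+1) natrM ler_wpM2r//.
by rewrite (le_trans hi)// ler_nat; lia.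
Qed.

Section draws.
Import mathcomp.boot.fintype mathcomp.boot.finset.
Local Open Scope set_scope.

(** Removing A is a bijection onto the subsets of size k - #|A| of the complement
of the union of A and B. *)
Lemma card_draws_between (V : finType) (A B : {set V}) (k : nat) :
  [disjoint A & B]%B -> (#|A| <= k)%N ->
  #|[set x : {set V} | (A \subset x) && (x \subset ~: B) && (#|x| == k)]| =
  'C(#|V| - (#|A| + #|B|), k - #|A|).
Proof.
move=> AB Ak; set D := [set y : {set V} | (y \subset ~: (A :|: B)) && (#|y| == k - #|A|)%N].
have cardAB : #|~: (A :|: B)| = (#|V| - (#|A| + #|B|))%N.
  by rewrite cardsCs setCK cardsU (disjoint_setI0 AB) cards0 subn0.
have DA y : y \in D -> [disjoint A & y]%B.
  by rewrite inE setCU subsetI disjoint_sym disjoints_subset => /andP[/andP[]].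
rewrite -cardAB -cards_draws -/D -(@card_in_imset _ _ (setU A) D).
  apply/eq_card => x; rewrite inE; apply/andP/imsetP => [[/andP[Ax xB] xk]|[y yD ->]].
    exists (x :\: A).
      rewrite inE cardsD (setIidPr Ax) (eqP xk) eqxx andbT setCU subsetI.
      by rewrite setDE subsetIr (subset_trans (subsetIl _ _)).
    by rewrite -[in LHS](setID x A) (setIidPr Ax).
  have yA := disjoint_setI0 (DA _ yD).
  move: yD; rewrite inE setCU subsetI => /andP[/andP[_ yB] yk].
  by rewrite subsetUl subUset -disjoints_subset AB yB cardsU yA cards0 subn0 (eqP yk) subnKC.
have recover y : y \in D -> ~: A :&: (A :|: y) = y.
  by rewrite setIUr setIC setICr set0U => /DA; rewrite disjoint_sym disjoints_subset => /setIidPr.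
by move=> y z /recover {2}<- /recover {2}<- ->.
Qed.

End draws.

(** * Independent discrete random variables *)

Lemma probability_sum_fibers (R : realType) (d : measure_display)
    (T : measurableType d) (P : probability T R) (V : finType)
    (X : T -> V) (H : set T) (C : {set V}) :
  measurable H -> (forall v, measurable (X @^-1` [set v])) ->
  (P (H `&` X @^-1` [set` C]) = \sum_(v in C) P (H `&` X @^-1` [set v]))%E.
Proof.
move=> mH mX.
have -> : H `&` X @^-1` [set` C] = \bigcup_(v in [set` C]) (H `&` X @^-1` [set v]).
  apply/seteqP; split=> [w [Hw XC]|w [v vC [Hw Xv]]]; first by exists (X w).
  by split=> //=; rewrite Xv.
rewrite measure_fin_bigcup //=.
- rewrite -big_enum [RHS]fsbig_seq ?enum_uniq //=; apply: eq_fsbigl.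
  by apply/seteqP; split=> v; rewrite /= mem_enum.
- by move=> u v _ _ [w [[_ <-] [_ <-]]].
- by move=> v _; apply: measurableI.
Qed.

Section independence.
Variables (R : realType) (d : measure_display) (T : measurableType d).
Variables (P : probability T R) (V : nat -> finType) (X : forall n, T -> V n).
Hypothesis mX : forall n v, measurable (X n @^-1` [set v]).
Hypothesis indep_atoms : forall (s : seq nat) (x : forall n, V n), uniq s ->
  P (\bigcap_(n in [set` s]) (X n @^-1` [set x n])) =
  (\prod_(n <- s) P (X n @^-1` [set x n]))%E.

Lemma measurable_fibers_in n (C : {set V n}) : measurable (X n @^-1` [set` C]).
Proof.
have -> : X n @^-1` [set` C] = \bigcup_(v in [set` C]) (X n @^-1` [set v]).
  by apply/seteqP; split=> [w XC|w [v vC Xv]]; [|by rewrite /= Xv]; exists (X n w).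
by apply: fin_bigcup_measurable.
Qed.

(** Induction on the number of rounds constrained by a set rather than by a value:
a constraint to C n is the disjoint union of constraints to its elements, and
the statement for mixed constraints is stable under this summation. *)
Lemma independent_events (s : seq nat) (C : forall n, {set V n}) : uniq s ->
  P (\bigcap_(n in [set` s]) (X n @^-1` [set` C n])) =
  (\prod_(n <- s) P (X n @^-1` [set` C n]))%E.
Proof.
(* A point of T provides the default values of the mixed constraints. *)
have [w0 _] : [set: T] !=set0.
  apply/set0P/eqP => T0; have := probability_setT P.
  by rewrite T0 measure0 => /esym/eqP; rewrite onee_eq0.
suff mixed s1 s2 x : uniq (s1 ++ s2) ->
    P (\bigcap_(n in [set` s1]) (X n @^-1` [set` C n]) `&`
       \bigcap_(n in [set` s2]) (X n @^-1` [set x n])) =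
    (\prod_(n <- s1) P (X n @^-1` [set` C n]) *
     \prod_(n <- s2) P (X n @^-1` [set x n]))%E.
  move=> us; have := mixed s [::] (X ^~ w0).
  by rewrite cats0 big_nil mule1 !bigcap_seq big_nil setIT => ->.
elim: s1 s2 x => [|n s1 IH] s2 x.
  by move=> us2; rewrite big_nil mul1e bigcap_seq big_nil setTI indep_atoms.
rewrite cat_cons cons_uniq mem_cat negb_or => /andP[/andP[ns1 ns2] us].
have -> : \bigcap_(m in [set` n :: s1]) (X m @^-1` [set` C m]) `&`
    \bigcap_(m in [set` s2]) (X m @^-1` [set x m]) =
    (\bigcap_(m in [set` s1]) (X m @^-1` [set` C m]) `&`
    \bigcap_(m in [set` s2]) (X m @^-1` [set x m])) `&` X n @^-1` [set` C n].
  by rewrite !bigcap_seq big_cons -setIA setIC.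
have mcap (r : seq nat) (F : nat -> set T) : (forall m, measurable (F m)) ->
    measurable (\bigcap_(m in [set` r]) F m).
  by move=> mF; apply: fin_bigcap_measurable => [|m _]; [exact: finite_seq|exact: mF].
rewrite probability_sum_fibers //; last first.
  by apply: measurableI; apply: mcap => // m; exact: measurable_fibers_in.
set K := (\prod_(m <- s1) P (X m @^-1` [set` C m]) *
          \prod_(m <- s2) P (X m @^-1` [set x m]))%E.
have atom v : P (\bigcap_(m in [set` s1]) (X m @^-1` [set` C m]) `&`
    \bigcap_(m in [set` s2]) (X m @^-1` [set x m]) `&` X n @^-1` [set v]) =
    (K * P (X n @^-1` [set v]))%E.
  have xE m : m \in s2 -> dfwith x n v m = x m.
    by move=> ms2; rewrite dfwithout //; apply: contraNneq ns2 => ->.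
  have {}us : uniq (s1 ++ n :: s2).
    by rewrite -cat1s uniq_catCA cat1s /= mem_cat negb_or ns1 ns2.
  have prodE : (\prod_(m <- n :: s2) P (X m @^-1` [set dfwith x n v m]) =
      P (X n @^-1` [set v]) * \prod_(m <- s2) P (X m @^-1` [set x m]))%E.
    rewrite big_cons dfwithin; congr (_ * _)%E.
    by apply: eq_big_seq => m ms2; rewrite xE.
  rewrite /K -muleA [X in (_ * X)%E]muleC -prodE.
  rewrite -IH // -setIA; congr (P (_ `&` _)).
  rewrite [RHS]bigcap_seq big_cons -bigcap_seq dfwithin setIC; congr (_ `&` _).
  by apply: eq_bigcapr => m /= ms2; rewrite xE.
under eq_bigr do rewrite atom.
rewrite -ge0_sume_distrr; last by [].
have := probability_sum_fibers P (C n) measurableT (mX (n:=n)).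
rewrite setTI; under [X in _ = X -> _]eq_bigr do rewrite setTI.
by move=> <-; rewrite big_cons [LHS]muleC [LHS]muleA.
Qed.

Lemma prod_le_expe (I : eqType) (s : seq I) (F : I -> \bar R) (r : R) :
  (forall i, i \in s -> 0 <= F i <= r%:E)%E ->
  (\prod_(i <- s) F i <= (r ^+ size s)%:E)%E.
Proof.
elim: s => [|i s IH] Fr; first by rewrite big_nil expr0.
have /andP[F0 Fir] := Fr i (mem_head _ _).
have Fs j : j \in s -> (0 <= F j <= r%:E)%E by move=> js; rewrite Fr // inE js orbT.
rewrite big_cons exprS EFinM lee_pmul ?IH // big_seq.
by apply: prode_ge0 => j /Fs /andP[].
Qed.

(** By independence, the event that all rounds N, ..., N + m - 1 fall in the sets
C n has probability at most r ^ m, for every m. *)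
Lemma independent_negligible (C : forall n, {set V n}) (r : R) (N : nat) :
  r < 1 -> (forall n, (N <= n)%N -> (P (X n @^-1` [set` C n]) <= r%:E)%E) ->
  P.-negligible (\bigcap_(n in [set n | (N <= n)%N]) (X n @^-1` [set` C n])).
Proof.
move=> r1 PCr; set F := \bigcap_(n in _) _.
have mF : measurable F.
  by apply: bigcap_measurableType => n _; exact: measurable_fibers_in.
apply/negligibleP => //; suff : P F = 0%E by [].
have r0 : 0 <= r by rewrite -lee_fin (le_trans _ (PCr N (leqnn N))).
have PF m : (P F <= (r ^+ m)%:E)%E.
  apply: (@le_trans _ _ (P (\bigcap_(n in [set` iota N m]) (X n @^-1` [set` C n])))).
    apply: le_measure; rewrite ?inE //.
      apply: fin_bigcap_measurable => [|n _]; [exact: finite_seq|].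
      exact: measurable_fibers_in.
    move=> w Fw n; rewrite /= mem_iota => /andP[Nn _]; exact: Fw.
  rewrite independent_events ?iota_uniq // -[X in r ^+ X](size_iota N).
  apply: prod_le_expe => n; rewrite mem_iota => /andP[Nn _].
  by rewrite measure_ge0 PCr.
have PFfin : P F \is a fin_num by exact: fin_num_measure.
apply/eqP; rewrite eq_le measure_ge0 andbT -(fineK PFfin) lee_fin.
have cvgP : cst (fine (P F)) x @[x --> \oo] --> fine (P F) by exact: cvg_cst.
have cvgr : r ^+ m @[m --> \oo] --> (0 : R) by apply: cvg_expr; rewrite ger0_norm.
apply: (ler_cvg_to cvgP cvgr).
by apply: nearW => m; rewrite /= -lee_fin fineK.
Qed.

End independence.

(** * The double random process *)

(** The sum is the ratio C(n - a - b, k - a) / C(n, k) for a = #|A| and b = #|B|. *)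
Lemma sum_uniform_subset_pmf_ge (R : realType) (n k : nat) (A B : {set 'I_n})
    (delta : R) : 0 <= delta ->
  [disjoint A & B]%B -> (#|A| <= k)%N -> (k + #|B| <= n)%N ->
  delta * n%:R <= k%:R - #|A|%:R -> delta * n%:R <= n%:R - k%:R - #|B|%:R ->
  delta ^+ (#|A| + #|B|) <=
    \sum_(a : {set 'I_n} | (A \subset a) && (a \subset ~: B))
      uniform_subset_pmf R k a.
Proof.
move=> d0 AB Ak kB hk hnk; rewrite /uniform_subset_pmf -big_mkcondr /=.
rewrite sumr_const -cardsE card_draws_between // card_ord -[leRHS]mulr_natl.
rewrite ler_pdivlMr ?ltr0n ?bin_gt0; last by rewrite (leq_trans _ kB) ?leq_addr.
have := @bin_ge_expr R delta #|A| #|B| (k - #|A|) (n - k - #|B|) d0.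
have -> : (#|A| + #|B| + (k - #|A| + (n - k - #|B|)) = n)%N by lia.
have -> : (#|A| + (k - #|A|) = k)%N by lia.
have -> : (n - (#|A| + #|B|) = k - #|A| + (n - k - #|B|))%N by lia.
by apply; rewrite !natrB //; lia.
Qed.

Definition initial_part (n : nat) (s : seq nat) : {set 'I_n} :=
  [set i : 'I_n | val i \in s]%SET.

Lemma card_initial_part n s : (#|initial_part n s| <= size s)%N.
Proof.
rewrite cardE -(size_map val); apply: uniq_leq_size.
  by rewrite (map_inj_uniq val_inj) enum_uniq.
by move=> _ /mapP[i + ->]; rewrite mem_enum inE.
Qed.

Section process.
Variables (R : realType) (d : measure_display) (T : measurableType d).
Variables (P : probability T R) (D : double_random_process P).

(** The degree is stored as an ordinal so that a round takes finitely many values,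
as [independent_events] requires. *)
Definition round (n : nat) (w : T) : 'I_n.+1 * {set 'I_n} :=
  (inord (degree D n w), nbrs D n w).

Lemma round_preimage n (v : 'I_n.+1 * {set 'I_n}) :
  round n @^-1` [set v] =
  degree D n @^-1` [set val v.1] `&` nbrs D n @^-1` [set v.2].
Proof.
apply/seteqP; split=> w; rewrite /round /=; case: v => k a /=.
  by move=> [<- <-]; rewrite inordK // ltnS degree_le.
by move=> [-> ->]; rewrite inord_val.
Qed.

Lemma measurable_degree n (K : set nat) : measurable (degree D n @^-1` K).
Proof. by rewrite -[_ @^-1` _]setTI; apply: measurable_funP. Qed.

Lemma measurable_round n v : measurable (round n @^-1` [set v]).
Proof.
rewrite round_preimage; apply: measurableI; first exact: measurable_degree.
exact: nbrs_measurable.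
Qed.

Lemma sigma_generated_degree n (K : set nat) :
  sigma_generated (degree D) (degree D n @^-1` K).
Proof. by apply: sub_sigma_algebra; exists n, K. Qed.

Lemma sigma_generated_degrees (s : seq nat) (K : nat -> set nat) :
  sigma_generated (degree D) (\bigcap_(n in [set` s]) (degree D n @^-1` K n)).
Proof.
rewrite /sigma_generated; set G := (X in <<s X>>).
apply: (@fin_bigcap_measurable _ (g_sigma_algebraType G)); first exact: finite_seq.
by move=> n _; exact: sigma_generated_degree.
Qed.

(** Fixing the degrees on the rounds of s is an event E of the degree sequence, on
which the conditional law of the neighbourhoods is a constant; the probability
of E splits by independence of the degrees. *)
Lemma rounds_law (s : seq nat) (x : forall n, 'I_n.+1 * {set 'I_n}) : uniq s ->
  P (\bigcap_(n in [set` s]) (round n @^-1` [set x n])) =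
  (\prod_(n <- s) (P (degree D n @^-1` [set val (x n).1]) *
     (uniform_subset_pmf R (x n).1 (x n).2)%:E))%E.
Proof.
move=> us; pose J := [fset n | n in s]%fset.
have Js : [set` J] = [set` s] by apply/seteqP; split=> n; rewrite /= inE.
have perm_Js : perm_eq J s by apply: uniq_perm => // n; rewrite inE.
set E := \bigcap_(n in [set` s]) (degree D n @^-1` [set val (x n).1]).
have mE : measurable E.
  by apply: fin_bigcap_measurable => [|n _]; [exact: finite_seq|exact: measurable_degree].
under eq_bigcapr do rewrite round_preimage.
rewrite bigcapI -/E -Js nbrs_cond_law; last exact: sigma_generated_degrees.
pose c := \prod_(n <- s) uniform_subset_pmf R (x n).1 (x n).2.
rewrite (eq_integral (cst c%:E)); last first.
  move=> w; rewrite inE => Ew; congr EFin; rewrite (perm_big _ perm_Js).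
  by apply: eq_big_seq => n /= ns; rewrite [degree D n w]Ew.
transitivity (c%:E * P E)%E; first exact: integral_cst.
rewrite /E -Js.
have -> := @degree_indep _ _ _ _ D J (fun n => [set val (x n).1]) _; last by [].
rewrite (perm_big _ perm_Js) /=.
by rewrite big_split /= /c muleC; congr (_ * _)%E; rewrite prodEFin.
Qed.

Lemma rounds_independent (s : seq nat) (x : forall n, 'I_n.+1 * {set 'I_n}) :
  uniq s ->
  P (\bigcap_(n in [set` s]) (round n @^-1` [set x n])) =
  (\prod_(n <- s) P (round n @^-1` [set x n]))%E.
Proof.
move=> us; rewrite rounds_law //; apply: eq_bigr => n _.
by have := @rounds_law [:: n] x isT; rewrite bigcap_seq !big_seq1 => ->.
Qed.

(** The event on the degree is carried along because the sum under the integral has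
a good lower bound only when the degree is neither too small nor too large. *)
Lemma nbrs_law n (K : set nat) (S : {set {set 'I_n}}) :
  P (degree D n @^-1` K `&` nbrs D n @^-1` [set` S]) =
  (\int[P]_(w in degree D n @^-1` K)
     (\sum_(a in S) uniform_subset_pmf R (degree D n w) a)%:E)%E.
Proof.
rewrite probability_sum_fibers; [|exact: measurable_degree|exact: nbrs_measurable].
under [RHS]eq_integral do rewrite -sumEFin -big_enum.
rewrite -big_enum (@ge0_integral_sum _ _ _ P _ _ _
  (fun a w => (uniform_subset_pmf R (degree D n w) a)%:E)); first last.
- by move=> a w _; rewrite lee_fin /uniform_subset_pmf; case: ifP; rewrite ?invr_ge0.
- move=> a mK Y mY; apply: measurableI => //.
  exact: (measurable_degree n [set k | Y (uniform_subset_pmf R k a)%:E]).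
- exact: measurable_degree.
apply: eq_bigr => a _.
(* The conditional law is stated for a whole family of subsets, of which only
   the n-th one matters here. *)
have := @nbrs_cond_law _ _ _ _ D [fset n]%fset (dfwith (fun m => finset.set0 : {set 'I_m}) n a) _
  (sigma_generated_degree n K).
rewrite bigcap_seq /= big_seq_fset1 dfwithin => ->.
by under [LHS]eq_integral do rewrite big_seq_fset1 dfwithin.
Qed.

Lemma measurable_nbrs n (S : {set {set 'I_n}}) :
  measurable (nbrs D n @^-1` [set` S]).
Proof.
exact: (measurable_fibers_in (X := nbrs D) (@nbrs_measurable _ _ _ _ D)).
Qed.

(** Restricting to the event that the degree lies between eps n and (1 - eps) n, the
integrand of [nbrs_law] is at least delta ^ (#|A| + #|B|).  The slack between
delta and eps absorbs the sizes of A and B. *)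
Lemma nbrs_between_ge n (A B : {set 'I_n}) (eps delta p0 : R) :
  0 <= delta -> 2 * delta <= eps -> [disjoint A & B]%B ->
  #|A|%:R <= delta * n%:R -> #|B|%:R <= delta * n%:R ->
  (p0%:E <= P [set w | (eps * n%:R <= (degree D n w)%:R <= (1 - eps) * n%:R)%R])%E ->
  ((delta ^+ (#|A| + #|B|) * p0)%:E <=
   P (nbrs D n @^-1` [set` [set a : {set 'I_n} | (A \subset a) && (a \subset ~: B)]%SET]))%E.
Proof.
move=> d0 d_eps AB hA hB hp0.
set S := [set a | _]%SET; set c := delta ^+ _.
pose K := [set k : nat | eps * n%:R <= k%:R <= (1 - eps) * n%:R].
have mK : measurable (degree D n @^-1` K) by exact: measurable_degree.
apply: (@le_trans _ _ (P (degree D n @^-1` K `&` nbrs D n @^-1` [set` S]))); last first.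
  apply: le_measure; rewrite ?inE; [|exact: measurable_nbrs|exact: subIsetr].
  by apply: measurableI => //; exact: measurable_nbrs.
rewrite nbrs_law; apply: (@le_trans _ _ (\int[P]_(w in degree D n @^-1` K) cst c%:E w)%E).
  by rewrite integral_cst // EFinM lee_wpmul2l // lee_fin exprn_ge0.
apply: ge0_le_integral => //.
- by move=> w _; rewrite lee_fin exprn_ge0.
- move=> _ Y mY; apply: measurableI => //.
  exact: (measurable_degree n [set k | Y (\sum_(a in S) uniform_subset_pmf R k a)%:E]).
move=> w /= /andP[lo hi]; rewrite lee_fin.
under eq_bigl do rewrite inE.
have dn : 2 * (delta * n%:R) <= eps * n%:R by rewrite mulrA ler_wpM2r.
have dn0 : 0 <= delta * n%:R by rewrite mulr_ge0.
have hi' : (degree D n w)%:R + eps * n%:R <= n%:R :> R.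
  by move: hi; rewrite mulrBl mul1r; lra.
apply: sum_uniform_subset_pmf_ge => //.
- by rewrite -(ler_nat R); lra.
- by rewrite -(ler_nat R) natrD; lra.
- lra.
- lra.
Qed.

(** The edges between v_n and earlier vertices are decided in round n alone. *)
Lemma process_graph_extends w n (A B : seq nat) :
  {in A ++ B, forall a, (a < n)%N} ->
  initial_part n A \subset nbrs D n w ->
  nbrs D n w \subset ~: initial_part n B ->
  [/\ n \notin A ++ B, {in A, forall a, process_graph D w n a} &
      {in B, forall b, ~~ process_graph D w n b}].
Proof.
move=> ltn /fintype.subsetP hA /fintype.subsetP hB; split.
- by apply/negP => /ltn; rewrite ltnn.
- move=> a aA; have an : (a < n)%N by rewrite ltn // mem_cat aA.
  apply/orP; left; apply/existsP; exists (Ordinal an).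
  by rewrite hA ?inE //=.
- move=> b bB; have bn : (b < n)%N by rewrite ltn // mem_cat bB orbT.
  apply/norP; split; apply/negP => /existsP[k /andP[kn /eqP kE]].
    by move: (hB _ kn); rewrite !inE kE bB.
  by have := ltn_ord k; rewrite kE ltnNge (ltnW bn).
Qed.

End process.

(** Late rounds realize the pair with probability at least c, so the rounds that
fail to do so satisfy the hypothesis of [independent_negligible] with r = 1 - c. *)
Lemma extension_pair_ae (R : realType) (d : measure_display)
    (T : measurableType d) (P : probability T R) (D : double_random_process P)
    (eps p0 : R) (M : nat) (A B : seq nat) :
  0 < eps -> 0 < p0 ->
  (forall n : nat, (M <= n)%N ->
     (p0%:E <= P [set w | (eps * n%:R <= (degree D n w)%:R
                             <= (1 - eps) * n%:R)%R])%E) ->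
  {in A, forall a, a \notin B} ->
  {ae P, forall w, exists n, [/\ n \notin A ++ B,
    {in A, forall a, process_graph D w n a} &
    {in B, forall b, ~~ process_graph D w n b}]}.
Proof.
move=> eps0 p00 hD AB.
(* With delta <= 1 its powers decrease, which is needed because the lists A and B
   may repeat vertices: their sizes only bound those of the initial parts. *)
pose delta : R := Num.min (eps / 2) 1.
have delta0 : 0 < delta by rewrite lt_min ltr01 andbT divr_gt0.
have delta1 : delta <= 1 by rewrite ge_min lexx orbT.
have delta_eps : 2 * delta <= eps.
  by rewrite -ler_pdivlMl // mulrC ge_min lexx.
(* From N on, the degree hypothesis holds, all of A and B has been created, and
   the sizes of A and B are at most delta * n. *)
pose top := (\max_(a <- A ++ B) a)%N.
pose N := (M + top.+1 +
  Num.bound ((size A + size B)%:R / delta))%N.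
have AB_lt n : (N <= n)%N -> {in A ++ B, forall a, (a < n)%N}.
  move=> Nn a aAB; have atop : (a <= top)%N.
    exact: (@leq_bigmax_seq _ (A ++ B) xpredT id).
  by rewrite /N in Nn; lia.
have sizes n : (N <= n)%N -> (size A + size B)%:R <= delta * n%:R.
  move=> Nn; rewrite -ler_pdivrMl // mulrC.
  apply/ltW/(lt_le_trans (archi_boundP _)); first by rewrite divr_ge0 // ltW.
  by rewrite ler_nat (leq_trans _ Nn) // leq_addl.
pose S n := [set a : {set 'I_n} |
  (initial_part n A \subset a) && (a \subset ~: initial_part n B)]%SET.
pose C n := [set v : 'I_n.+1 * {set 'I_n} | v.2 \notin S n]%SET.
pose c := delta ^+ (size A + size B) * p0.
have c0 : 0 < c by rewrite mulr_gt0 // exprn_gt0.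
have PC n : (N <= n)%N -> (P (round D n @^-1` [set` C n]) <= (1 - c)%:E)%E.
  move=> Nn; have -> : round D n @^-1` [set` C n] = ~` (nbrs D n @^-1` [set` S n]).
    by apply/seteqP; split=> w /=; rewrite !inE => /negP.
  rewrite probability_setC; last exact: measurable_nbrs.
  rewrite EFinB leeB //.
  have dAB : [disjoint initial_part n A & initial_part n B]%B.
    rewrite finset.disjoints_subset; apply/fintype.subsetP => i.
    by rewrite !inE; exact: AB.
  have size_n := sizes n Nn.
  have cA := card_initial_part n A; have cB := card_initial_part n B.
  have := @nbrs_between_ge _ _ _ _ D n (initial_part n A) (initial_part n B)
    eps delta p0 (ltW delta0) delta_eps dAB.
  move=> /(_ _ _ (hD n _)) hP; apply: le_trans (hP _ _ _).
  - rewrite lee_fin ler_wpM2r ?(ltW p00) // ler_wiXn2l ?(ltW delta0) //.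
    exact: leq_add.
  - by apply: le_trans size_n; rewrite ler_nat; lia.
  - by apply: le_trans size_n; rewrite ler_nat; lia.
  - by rewrite (leq_trans _ Nn) // /N -addnA leq_addr.
have := @independent_negligible _ _ _ P (fun n => ('I_n.+1 * {set 'I_n})%type)
  (round D) (@measurable_round _ _ _ _ D) (@rounds_independent _ _ _ _ D)
  C (1 - c) N _ PC.
rewrite ltrBlDr ltrDl => /(_ c0); apply: negligibleS => w nextends n Nn.
rewrite /= inE; apply/negP; rewrite inE => /andP[hA hB]; apply: nextends.
by exists n; exact: process_graph_extends (AB_lt n Nn) hA hB.
Qed.

Theorem corollary4p4 (R : realType) (d : measure_display)
    (T : measurableType d) (P : probability T R)
    (D : double_random_process P)
    (hD : exists (eps p0 : R) (M : int),
      [/\ 0 < eps, 0 < p0 &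
          forall n : nat, M < n%:Z ->
            (p0%:E <= P [set w | (eps * n%:R <= (degree D n w)%:R
                                    <= (1 - eps) * n%:R)%R])%E]) :
  {ae P, forall w, graph_isomorphic (process_graph D w) rado_graph}.
Proof.
have [eps [p0 [M [eps0 p00 hM]]]] := hD.
have hM' n : (`|M|.+1 <= n)%N -> (p0%:E <= P [set w |
    (eps * n%:R <= (degree D n w)%:R <= (1 - eps) * n%:R)%R])%E.
  by move=> Mn; apply: hM; lia.
(* Pairs that are not disjoint are kept, with a vacuous requirement, so that all
   pairs are enumerated by their codes. *)
pose extends (AB : seq nat * seq nat) w :=
  {in AB.1, forall a, a \notin AB.2} -> exists n, [/\ n \notin AB.1 ++ AB.2,
    {in AB.1, forall a, process_graph D w n a} &
    {in AB.2, forall b, ~~ process_graph D w n b}].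
have extends_ae i : {ae P, forall w,
    if choice.unpickle i is Some AB then extends AB w else True}.
  case: (choice.unpickle i) => [[A B]|]; last by apply: aeW.
  have [AB|nAB] := pselect {in A, forall a, a \notin B}; last by apply: aeW => w AB; case: nAB.
  by have := extension_pair_ae eps0 p00 hM' AB; apply: filterS => w ext _.
have := ae_foralln extends_ae.
apply: filterS => w ext; apply: extension_property_isomorphic.
  move=> A B AB; have := ext (choice.pickle (A, B)).
  by rewrite choice.pickleK; apply.
exact/rado_extension_property/rado_graphP.
Qed.
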